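(* Let $p,n,t$ be positive integers with $2\le t\le \frac n2+2$ and $p\ge n\ge 4$. If $G$ is an $(n,n-t)$ graph of order $p$, then $$\alpha(G)\ge \left\lfloor\frac{p-\left\lfloor\frac{n+4-2t}3\right\rfloor}2\right\rfloor+1.$$
   Context: All graphs are finite and simple; the order of a graph is its number of vertices. For integers $n\ge 1$ and $m\ge 0$, a graph $G$ is an $(n,m)$ graph if every subgraph of $G$ induced by $n$ vertices has at most $m$ edges. $\alpha(G)$ is the independence number of $G$ and $\lfloor x\rfloor$ is the greatest integer not exceeding $x$. *)

(* Defs.v *)
From mathcomp Require Import all_boot.

Set Implicit Arguments.
Unset Strict Implicit.
Unset Printing Implicit Defensive.

(* A finite simple graph is given by its adjacency relation on a finite vertex
   type; the order of the graph is #|T|. *)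
Definition simple_graph (T : finType) (e : rel T) : Prop :=
  symmetric e /\ irreflexive e.

(* Edges are unordered pairs, so each edge is counted once although e relates
   its endpoints in both directions. *)
Definition induced_edges (T : finType) (e : rel T) (A : {set T}) :
    {set {set T}} :=
  [set [set x; y] | x in A, y in A & e x y].

Definition nm_graph (T : finType) (e : rel T) (n m : nat) : Prop :=
  forall A : {set T}, #|A| = n -> #|induced_edges e A| <= m.

Definition independent (T : finType) (e : rel T) (A : {set T}) : bool :=
  [forall x in A, forall y in A, ~~ e x y].

Definition independence_number (T : finType) (e : rel T) : nat :=
  \max_(A : {set T} | independent e A) #|A|.

(* Main.v *)
Require Import Defs.
From mathcomp Require Import all_boot zify.

Set Implicit Arguments.
Unset Strict Implicit.
Unset Printing Implicit Defensive.

(** Write [p] for the order, [a] for the independence number and [d = p - 2 a].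
    If [d < 0] the bound is immediate, and otherwise it amounts to
    [3 d + 2 t <= n + 1].  The hypothesis caps the edges on [n] vertices at
    [n - t], so it suffices to find [n] vertices that span either at least
    [n - 1] edges, which contradicts [2 <= t], or [E] edges with
    [n + 3 d <= 2 E + 1].

    Let [U] be an inclusion-minimal vertex set in which every independent set
    [I] satisfies [2 #|I| + d <= #|U|].  Two facts about [U] are used.
    - No vertex [x] has fewer than two neighbours in [U].  Otherwise deleting [x]
      and its neighbours costs at most two vertices, while [x] extends every
      independent set of the remainder, so the remainder would have the same
      property ([min_gapped_degree]).
    - Every vertex set [W] contains an independent set [I] with
      [2 #|W| <= E(W) + 3 #|I|], a weak form of Turan's theorem
      ([independent_subset]).  Applied to [U] it gives [#|U| + 3 d <= 2 E(U)].

    If [U] has more than [n] vertices, grow a set inside [U] one adjacent vertex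
    at a time.  When no adjacent vertex remains, the set is a union of
    components of [U]; its degrees are at least 2, so it has as many edges as
    vertices and a free restart is affordable.  This ends with [n] vertices and
    at least [n - 1] edges ([sparse_subset_of_min_degree2]).

    If [U] has at most [n] vertices, enlarge it by edges.  An edge not yet
    inside adds at most two vertices and at least one edge, so
    [#|S| + 3 d <= 2 E(S)] persists.  The process stops at [n - 1] or [n]
    vertices, or when all edges of the graph are inside; in the last case the
    inequality for the whole graph is the one needed ([extend_along_edges]).

    Twice the number of edges, as a sum of degrees, is the convenient count. *)

(** * Degrees and arcs inside a vertex set *)

Section InducedSubgraphs.

Variables (T : finType) (e : rel T).
Hypotheses (e_sym : symmetric e) (e_irr : irreflexive e).
Implicit Types (x y : T) (S U W I : {set T}) (d n : nat).

Definition degree_in S x := #|[set y in S | e x y]|.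

Definition arcs S := \sum_(x in S) degree_in S x.

Lemma degree_in_setU1 S x y : x \notin S ->
  degree_in (x |: S) y = e y x + degree_in S y.
Proof.
move=> xS; rewrite /degree_in (cardsD1 x) !inE eqxx /=; congr (_ + #|pred_of_set _|).
apply/setP=> z; rewrite !inE; case: (eqVneq z x) => // ->.
by rewrite (negPf xS).
Qed.

Lemma arcs_setU1 S x : x \notin S -> arcs (x |: S) = arcs S + 2 * degree_in S x.
Proof.
move=> xS; rewrite /arcs big_setU1 //= degree_in_setU1 // e_irr add0n.
under eq_bigr => y _ do rewrite degree_in_setU1 //.
rewrite big_split /=; suff -> : \sum_(y in S) e y x = degree_in S x by lia.
rewrite /degree_in -sum1_card big_mkcond [RHS]big_mkcond /=.
by apply: eq_bigr => y _; rewrite inE e_sym; case: (y \in S); case: (e x y).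
Qed.

Lemma arcs_setD1 W x : x \in W -> arcs W = arcs (W :\ x) + 2 * degree_in W x.
Proof.
move=> xW; have xD : x \notin W :\ x by rewrite setD11.
have eW := setD1K xW.
by rewrite -[in LHS]eW -[in degree_in W x]eW arcs_setU1 // degree_in_setU1 // e_irr.
Qed.

Lemma degree_inS S W x : S \subset W -> degree_in S x <= degree_in W x.
Proof.
move=> sSW; apply/subset_leq_card/subsetP=> y; rewrite !inE.
by case/andP=> /(subsetP sSW) -> ->.
Qed.

Lemma arcsS S W : S \subset W -> arcs S <= arcs W.
Proof.
move=> sSW; apply: (@leq_trans (\sum_(x in S) degree_in W x)).
  by apply: leq_sum => x _; exact: degree_inS.
by rewrite /arcs [leqRHS](big_setID S) /= (setIidPr sSW) leq_addr.
Qed.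

Lemma degree_in_gt0 S x y : y \in S -> e x y -> 0 < degree_in S x.
Proof. by move=> yS exy; apply/card_gt0P; exists y; rewrite inE yS. Qed.

(** Adding [x] to [S] creates one new edge for each neighbour of [x] in [S];
    hence an edge is counted at most twice by [arcs]. *)
Lemma arcs_le_induced_edges S : arcs S <= 2 * #|induced_edges e S|.
Proof.
elim: {S}#|S| {-2}S (leqnn #|S|) => [|k IHk] S.
  by rewrite leqn0 cards_eq0 => /eqP ->; rewrite /arcs big_set0.
move=> leSk; have [->|[x xS]] := set_0Vmem S; first by rewrite /arcs big_set0.
have/IHk : #|S :\ x| <= k by move: leSk; rewrite (cardsD1 x S) xS; lia.
rewrite (arcs_setD1 xS) => IH.
pose star := [set [set x; y] | y in [set y in S | e x y]].
have cstar : #|star| = degree_in S x.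
  apply: card_in_imset => y z; rewrite !inE => /andP[_ exy] /andP[_ exz].
  move/setP/(_ y); rewrite !inE eqxx orbT => /esym/orP[/eqP eyx|/eqP //].
  by rewrite eyx e_irr in exy.
have dis : [disjoint induced_edges e (S :\ x) & star].
  apply/pred0P=> A /=; apply/negP=> /andP[/imset2P[y z]].
  rewrite !inE => /andP[nyx _] /andP[/andP[nzx _] _] -> /imsetP[w _].
  by move/setP/(_ x); rewrite !inE eqxx /= [x == y]eq_sym [x == z]eq_sym
    (negPf nyx) (negPf nzx).
have sub : induced_edges e (S :\ x) :|: star \subset induced_edges e S.
  apply/subsetP=> A; rewrite inE => /orP[/imset2P[y z]|/imsetP[y]].
    rewrite !inE => /andP[_ yS] /andP[/andP[_ zS] eyz] ->.
    by apply/imset2P; exists y z; rewrite ?inE ?zS.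
  rewrite inE => /andP[yS exy] ->.
  by apply/imset2P; exists x y; rewrite ?inE ?yS.
have := subset_leq_card sub.
rewrite cardsU (disjoint_setI0 dis) cards0 cstar; lia.
Qed.

(** * Independent sets *)

Definition away x W := [set y in W | (y != x) && ~~ e x y].

Lemma away_sub x W : away x W \subset W :\ x.
Proof. by apply/subsetP=> y; rewrite !inE => /and3P[-> -> _]. Qed.

Lemma card_away x W : x \in W -> #|W| = #|away x W| + degree_in W x + 1.
Proof.
move=> xW; rewrite (cardsD1 x W) xW /= addnC; congr (_ + _).
rewrite -(cardsID [set y | e x y] (W :\ x)) addnC.
congr addn; apply: eq_card => y; rewrite !inE.
  by case: (e x y); case: (y == x); case: (y \in W).
by case: (eqVneq y x) => // ->; rewrite e_irr !andbF.
Qed.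

Lemma independent_add x W I : x \in W -> I \subset away x W -> independent e I ->
  [/\ x |: I \subset W, independent e (x |: I) & #|x |: I| = #|I|.+1].
Proof.
move=> xW sI indI; have xI : x \notin I.
  by apply/negP=> /(subsetP sI); rewrite !inE eqxx andbF.
have nx y : y \in I -> ~~ e x y by move/(subsetP sI); rewrite inE => /and3P[].
split; last by rewrite cardsU1 xI.
  rewrite subUset sub1set xW; apply: subset_trans sI _.
  exact: subset_trans (away_sub _ _) (subsetDl _ _).
apply/forall_inP=> y; rewrite !inE => yI; apply/forall_inP=> z; rewrite !inE => zI.
case/orP: yI => [/eqP ->|yI]; case/orP: zI => [/eqP ->|zI].
- by rewrite e_irr.
- exact: nx.
- by rewrite e_sym nx.
- by move/forall_inP: indI => /(_ y yI) /forall_inP/(_ z zI).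
Qed.

(** A vertex of degree at least 2 can be discarded, which removes two edges for
    one vertex; a vertex of degree at most 1 is put into the independent set
    and discarded with its neighbour. *)
Lemma independent_subset W :
  exists I : {set T}, [/\ I \subset W, independent e I & 4 * #|W| <= arcs W + 6 * #|I|].
Proof.
elim: {W}#|W| {-2}W (leqnn #|W|) => [|k IHk] W leWk.
  exists set0; split; rewrite ?sub0set //; last by lia.
  by apply/forall_inP=> x; rewrite inE.
have [->|[x xW]] := set_0Vmem W.
  exists set0; split; rewrite ?cards0 //.
  by apply/forall_inP=> x; rewrite inE.
have eW := cardsD1 x W; rewrite xW in eW.
have aW := arcs_setD1 xW.
case: (leqP 2 (degree_in W x)) => degx.
  have [|I [sI indI leI]] := IHk (W :\ x); first by lia.
  exists I; split=> //; last by lia.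
  exact: subset_trans sI (subsetDl _ _).
have cW := card_away xW.
have [|I [sI indI leI]] := IHk (away x W); first by lia.
have [sxI indxI cxI] := independent_add xW sI indI.
exists (x |: I); split=> //.
have := arcsS (away_sub x W); lia.
Qed.

Definition gapped d U :=
  [forall I : {set T}, (I \subset U) && independent e I ==> (2 * #|I| + d <= #|U|)].

Lemma gappedP d U :
  reflect (forall I, I \subset U -> independent e I -> 2 * #|I| + d <= #|U|)
          (gapped d U).
Proof.
apply: (iffP forallP) => [gap I sI indI | gap I].
  by have/implyP := gap I; rewrite sI indI => ->.
by apply/implyP=> /andP[sI indI]; exact: gap.
Qed.

Lemma arcs_gapped d U : gapped d U -> #|U| + 3 * d <= arcs U.
Proof.
move/gappedP=> gap; have [I [sI indI leI]] := independent_subset U.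
have := gap I sI indI; lia.
Qed.

(** Deleting a vertex of degree at most 1 together with its neighbour would keep
    the gap [d], because that vertex extends every independent set of the rest. *)
Lemma min_gapped_degree d U x : minset (gapped d) U -> x \in U ->
  2 <= degree_in U x.
Proof.
move=> minU xU; rewrite leqNgt; apply/negP=> degx.
have gap := gappedP _ _ (minsetp minU).
have cU := card_away xU.
suff gapA : gapped d (away x U).
  have sAU := subset_trans (away_sub x U) (subsetDl _ _).
  by have := minsetinf minU gapA sAU => eA; rewrite -{1}eA in cU; lia.
apply/gappedP=> I sI indI.
have [sxI indxI cxI] := independent_add xU sI indI.
have := gap _ sxI indxI; lia.
Qed.

(** * Dense subsets of prescribed size *)

Lemma superset_of_card n S : #|S| <= n -> n <= #|T| ->
  exists2 A : {set T}, S \subset A & #|A| = n.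
Proof.
move=> leSn lenT.
have [A maxA sSA] := @maxset_exists T (fun A : {set T} => #|A| <= n) S leSn.
exists A => //; have leA := maxsetp maxA; apply/eqP; rewrite eqn_leq leA leqNgt.
apply/negP=> ltA; have: A != setT.
  by apply/eqP=> eA; rewrite eA cardsT in ltA; lia.
rewrite -subTset => /subsetPn[x _ xA].
have := maxsetsup maxA (B := x |: A); rewrite subsetUr cardsU1 xA /= => /(_ ltA isT).
by move/setP/(_ x); rewrite setU11 (negPf xA).
Qed.

(** A maximal [S] with at most [n] vertices and at least [#|S| - 1] edges has [n]
    vertices: otherwise [S] has no neighbour in [U] outside it, its degrees are
    at least 2, and any further vertex could be added. *)
Lemma sparse_subset_of_min_degree2 n U :
    (forall x, x \in U -> 2 <= degree_in U x) -> n <= #|U| ->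
  exists2 S : {set T}, #|S| = n & 2 * n <= arcs S + 2.
Proof.
move=> degU lenU.
pose P S := [&& S \subset U, #|S| <= n & 2 * #|S| <= arcs S + 2].
have P0 : P set0 by rewrite /P sub0set cards0.
have [S maxS _] := maxset_exists P0.
have /and3P[sSU leSn leS] := maxsetp maxS.
case: (eqVneq #|S| n) => [eSn|neSn]; first by exists S => //; rewrite -eSn.
have stuck y : y \in U -> y \notin S -> arcs S + 2 * degree_in S y < 2 * #|S|.
  move=> yU yS; rewrite ltnNge; apply/negP=> le.
  have Py : P (y |: S).
    rewrite /P subUset sub1set yU sSU cardsU1 yS arcs_setU1 //.
    by apply/andP; split; lia.
  have /setP/(_ y) := maxsetsup maxS Py (subsetUr _ _).
  by rewrite setU11 (negPf yS).
have closed x y : x \in S -> y \in U -> e x y -> y \in S.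
  move=> xS yU exy; apply/negPn/negP=> yS.
  have := stuck y yU yS; rewrite e_sym in exy.
  have := degree_in_gt0 xS exy; lia.
have [y yU yS] : exists2 y, y \in U & y \notin S.
  apply/subsetPn/negP=> sUS; have := subset_leq_card sUS; lia.
suff : 2 * #|S| <= arcs S by have := stuck y yU yS; lia.
rewrite mulnC -sum_nat_const; apply: leq_sum => x xS.
apply: leq_trans (degU x (subsetP sSU x xS)) _.
apply/subset_leq_card/subsetP=> z; rewrite !inE => /andP[zU exz].
by rewrite (closed x).
Qed.

(** The [+ 1] pays for the case where growth stops at [n - 1] vertices: a new
    edge may need two more vertices, so the last vertex can come without one. *)
Lemma extend_along_edges n d U : #|U| <= n -> n <= #|T| ->
    #|U| + 3 * d <= arcs U -> #|T| + 3 * d <= arcs setT ->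
  exists2 S : {set T}, #|S| = n & n + 3 * d <= arcs S + 1.
Proof.
move=> leUn lenT leU leT.
pose P S := (#|S| <= n) && (#|S| + 3 * d <= arcs S).
have PU : P U by rewrite /P leUn.
have [S maxS _] := maxset_exists PU.
have /andP[leSn leS] := maxsetp maxS.
have [A sSA eAn] := superset_of_card leSn lenT.
exists A => //; have leSA := arcsS sSA.
case: (leqP n #|S|.+1) => [|ltSn]; first by lia.
have inside x y : e x y -> x \in S.
  move=> exy; apply/negPn/negP=> xS.
  (* Two vertices fit, so the edge [x y] could be added to [S]. *)
  suff PB : P (x |: (y |: S)).
    have sB : S \subset x |: (y |: S) by rewrite setUA subsetUr.
    by have /setP/(_ x) := maxsetsup maxS PB sB; rewrite setU11 (negPf xS).
  have nxy : x != y by apply/eqP=> exy'; rewrite exy' e_irr in exy.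
  have xyS : x \notin y |: S by rewrite !inE negb_or nxy.
  have := degree_in_gt0 (setU11 y S) exy.
  have := arcsS (subsetUr [set y] S).
  rewrite /P (arcs_setU1 xyS) cardsU1 xyS cardsU1; case: (y \in S) => /= *; apply/andP; split; lia.
suff : arcs setT <= arcs S by lia.
rewrite /arcs (bigID (mem S)) /= [X in _ + X]big1 ?addn0.
  rewrite (eq_bigl (mem S)) => [|x]; last by rewrite inE.
  apply: leq_sum => x _; apply/subset_leq_card/subsetP=> y.
  rewrite !inE /= => exy; rewrite exy andbT.
  by apply: (inside y x); rewrite e_sym.
move=> x /andP[_ xS]; apply/eqP; rewrite cards_eq0; apply/eqP/setP=> y.
by rewrite !inE /=; apply/negP=> /inside; apply/negP.
Qed.

Lemma dense_subset n d : gapped d setT -> n <= #|T| ->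
  exists2 S : {set T}, #|S| = n & (2 * n <= arcs S + 2) || (n + 3 * d <= arcs S + 1).
Proof.
move=> gapT lenT; have [U minU _] := minset_exists gapT.
have gapU := minsetp minU.
case: (leqP n #|U|) => [lenU|/ltnW leUn].
  have degU x : x \in U -> 2 <= degree_in U x by exact: min_gapped_degree minU.
  by have [S eS leS] := sparse_subset_of_min_degree2 degU lenU; exists S; rewrite ?leS.
have leT := arcs_gapped gapT; rewrite cardsT in leT.
have [S eS leS] := extend_along_edges leUn lenT (arcs_gapped gapU) leT.
by exists S; rewrite ?leS ?orbT.
Qed.

End InducedSubgraphs.

(** * The bound on the independence number *)

(* The hypotheses give t <= n, 2 * t <= n + 4 and (n + 4 - 2 * t) %/ 3 <= p,
   so none of the natural-number subtractions below truncates. *)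
Theorem theorem3p2 (p n t : nat) (T : finType) (e : rel T)
    (ht2 : 2 <= t) (htn : 2 * t <= n + 4) (hn : 4 <= n) (hnp : n <= p)
    (hG : simple_graph e) (hp : #|T| = p) (hnm : nm_graph e n (n - t)) :
  (p - (n + 4 - 2 * t) %/ 3) %/ 2 + 1 <= independence_number e.
Proof.
case: hG => e_sym e_irr.
have indle I : independent e I -> #|I| <= independence_number e.
  exact: (@leq_bigmax_cond _ (independent e) (fun A : {set T} => #|A|)).
move: (independence_number e) indle => a indle.
case: (ltnP p (2 * a)) => [|le2a]; first by lia.
have gapT : gapped e (p - 2 * a) setT.
  by apply/gappedP=> I _ /indle; rewrite cardsT; lia.
rewrite -hp in hnp.
have [S eS] := dense_subset e_sym e_irr gapT hnp.
have := arcs_le_induced_edges e_sym e_irr S; have := hnm S eS.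
move=> leE leA /orP[le|le]; lia.
Qed.
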